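(* Let $\mathbb{X},\mathbb{Y}$ be Euclidean spaces, $g:\mathbb{X}\to\mathbb{R}\cup\{+\infty\}$ closed, proper, convex, and put $\Theta:=\operatorname{epi} g^*\subset\mathbb{X}\times\mathbb{R}$. Let $\bar p=(\bar A,\bar b,\bar\mu,0)\in\mathcal{L}(\mathbb{X},\mathbb{Y})\times\mathbb{Y}\times\mathbb{R}\times\mathbb{X}$ with $\bar\mu>0$, and let $\bar u=(\bar y,\bar t)\in\mathbb{U}:=\mathbb{Y}\times\mathbb{R}$ be a solution of the problem $$D'(\bar p):\qquad \min_{(y,t)\in\mathbb{Y}\times\mathbb{R}}\ \tfrac{\bar\mu}{2}\|y\|^2-\langle\bar b,y\rangle+t\quad\text{s.t.}\quad(\bar A^*y,t)\in\operatorname{epi} g^*.$$ Suppose that $\bar\lambda=(\bar\lambda_1,-1)\in\mathbb{X}\times\mathbb{R}$ is a corresponding Lagrange multiplier at $(\bar y,\bar t)$, i.e. $$0=\bar\mu\bar y-\bar b+\bar A\bar\lambda_1,\qquad(\bar\lambda_1,-1)\in N_{\operatorname{epi} g^*}(\bar A^*\bar y,\bar t).$$ Then the generalized strong second-order sufficient condition holds for $D'(\bar p)$, i.e., for every $w\in\mathbb{U}\setminus\{0\}$, $$\langle w,\nabla^2_{uu}\mathscr{L}(\bar u,\bar p,\bar\lambda)w\rangle+\inf\big\{\langle z,\mathcal{J}_uG(\bar u,\bar p)w\rangle\,:\,z\in D^*N_\Theta(G(\bar u,\bar p)\,|\,\bar\lambda)(\mathcal{J}_uG(\bar u,\bar 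p)w)\big\}>0.$$
   Context: A Euclidean space is a finite-dimensional real inner product space; $\mathcal{L}(\mathbb{X},\mathbb{Y})$ is the space of linear operators, $A^*$ the adjoint. $g^*(y)=\sup_x\{\langle y,x\rangle-g(x)\}$ is the Fenchel conjugate and $\operatorname{epi} g^*=\{(z,t): g^*(z)\le t\}$. For $u=(y,t)\in\mathbb{Y}\times\mathbb{R}$, $p=(A,b,\mu,v)\in\mathcal{L}(\mathbb{X},\mathbb{Y})\times\mathbb{Y}\times\mathbb{R}\times\mathbb{X}$ and $\lambda=(\lambda_1,\lambda_2)\in\mathbb{X}\times\mathbb{R}$ set $$G(u,p):=(A^*y+v,t),\qquad \mathscr{L}(u,p,\lambda):=\tfrac{\mu}{2}\|y\|^2-\langle b,y\rangle+t+\langle\lambda_1,A^*y+v\rangle+\lambda_2t.$$ $\mathcal{J}_uG$ is the partial Jacobian (derivative) in $u$ and $\nabla^2_{uu}\mathscr{L}$ the partial Hessian in $u$. For a closed convex set $\Theta$, $N_\Theta(\bar x)=\{y:\langle y,x-\bar x\rangle\le0\ \forall x\in\Theta\}$ for $\bar x\in\Theta$ (and $N_\Theta(\bar x)=\emptyset$ otherwise); $N_\Theta$ is regarded as a set-valued mapping with graph $\operatorname{gph} N_\Theta=\{(x,y): y\in N_\Theta(x)\}$. For a general set $S$ in a Euclidean space and $\bar x\in S$, the regular normal cone is $\hat N_S(\bar x)=\{y:\limsup_{x\to\bar x,\,x\in S}\frac{\langle y,x-\bar x\rangle}{\|x-\bar x\|}\le0\}$, and the limiting normal cone is $N_S(\bar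 x)=\{y:\exists\,x_k\to\bar x,\ x_k\in S,\ y_k\in\hat N_S(x_k),\ y_k\to y\}$ (it agrees with the convex normal cone when $S$ is convex). The (limiting) coderivative of a set-valued mapping $F$ at $\bar x$ for $\bar y\in F(\bar x)$ is $D^*F(\bar x\,|\,\bar y)(w)=\{z:(z,-w)\in N_{\operatorname{gph} F}(\bar x,\bar y)\}$. The convention $\inf\emptyset=+\infty$ is used. *)

(* Defs.v *)
From HB Require Import structures.
From mathcomp Require Import all_boot all_order all_algebra.
From mathcomp Require Import all_classical all_reals all_analysis.

Set Implicit Arguments.
Unset Strict Implicit.
Unset Printing Implicit Defensive.

Import Order.TTheory GRing.Theory Num.Theory.
Import numFieldNormedType.Exports.

Local Open Scope classical_set_scope.
Local Open Scope ring_scope.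

(* The norm of the underlying normedModType is not required to be the one
   induced by the inner product: it only carries the topology and the
   differential calculus, which in finite dimension do not depend on the norm.
   This is what lets a product of Euclidean spaces, whose library norm is the
   max norm, be Euclidean for the sum of the inner products. The norm induced
   by the inner product is [enorm] below. *)
HB.mixin Record isEuclidean (R : realType) (V : Type)
    & NormedModule R V & Vector R V := {
  inner : {dot V for @idfun R}
}.

#[short(type="euclideanType")]
HB.structure Definition Euclidean (R : realType) :=
  {V of isEuclidean R V & NormedModule R V & Vector R V}.

Section inner_product.
Context {R : realType} {V : euclideanType R}.
Implicit Types x y z : V.

Definition dot x y : R := (inner : {dot V for @idfun R}) x y.

Definition enorm x : R := Num.sqrt (dot x x).

Lemma dotC x y : dot x y = dot y x.
Proof. by rewrite /dot hermitian_subproof expr0 mul1r. Qed.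

Lemma dotDl x y z : dot (x + y) z = dot x z + dot y z.
Proof. exact: linearDl. Qed.

Lemma dotZl (a : R) x z : dot (a *: x) z = a * dot x z.
Proof. exact: linearZl_LR. Qed.

Lemma dotDr x y z : dot z (x + y) = dot z x + dot z y.
Proof. by rewrite dotC dotDl !(dotC z). Qed.

Lemma dotZr (a : R) x z : dot z (a *: x) = a * dot z x.
Proof. by rewrite dotC dotZl (dotC z). Qed.

Lemma dot_gt0 x : x != 0 -> 0 < dot x x.
Proof. exact: neq0_dnorm_gt0. Qed.

Lemma dot_ge0 x : 0 <= dot x x.
Proof.
have [->|/dot_gt0/ltW//] := eqVneq x 0.
by rewrite -(scale0r (0 : V)) dotZl mul0r.
Qed.

End inner_product.

Section regular_euclidean.
Context (R : realType).

Definition regular_inner (x y : R^o) : R := (x : R) * (y : R).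

Let regular_bilinear : bilinear_for
  (GRing.Scale.Law.clone _ _ ( *%R ) _)
  (GRing.Scale.Law.clone _ _ (@idfun R \; *%R) _) regular_inner.
Proof.
split=> [y|x] a u v; rewrite /regular_inner/=.
  by rewrite mulrDl -mulrA.
by rewrite mulrDr mulrCA.
Qed.

HB.instance Definition _ :=
  @bilinear_isBilinear.Build R R^o R^o R _ _ regular_inner regular_bilinear.

Let regular_hermitian (x y : R^o) :
  regular_inner x y = (-1) ^+ false * @idfun R (regular_inner y x).
Proof. by rewrite expr0 mul1r /regular_inner mulrC. Qed.

HB.instance Definition _ := @isHermitianSesquilinear.Build R R^o false
  (@idfun R) regular_inner regular_hermitian.

Let regular_gt0 (x : R^o) : x != 0 -> 0 < regular_inner x x.
Proof. by move=> x0; rewrite /regular_inner -expr2 exprn_even_gt0. Qed.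

HB.instance Definition _ :=
  isDotProduct.Build R R^o regular_inner regular_gt0.

HB.instance Definition _ := @isEuclidean.Build R R^o regular_inner.

End regular_euclidean.

Section prod_euclidean.
Context (R : realType) (V W : euclideanType R).

Definition prod_inner (x y : V * W) : R := dot x.1 y.1 + dot x.2 y.2.

Let prod_bilinear : bilinear_for
  (GRing.Scale.Law.clone _ _ ( *%R ) _)
  (GRing.Scale.Law.clone _ _ (@idfun R \; *%R) _) prod_inner.
Proof.
split=> [y|x] a u v; rewrite /prod_inner/=.
  by rewrite !dotDl !dotZl mulrDr addrACA.
by rewrite !dotDr !dotZr mulrDr addrACA.
Qed.

HB.instance Definition _ := @bilinear_isBilinear.Build R (V * W)%type
  (V * W)%type R _ _ prod_inner prod_bilinear.

Let prod_hermitian (x y : V * W) :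
  prod_inner x y = (-1) ^+ false * @idfun R (prod_inner y x).
Proof. by rewrite expr0 mul1r /prod_inner/= dotC (dotC x.2). Qed.

HB.instance Definition _ := @isHermitianSesquilinear.Build R (V * W)%type false
  (@idfun R) prod_inner prod_hermitian.

Let prod_gt0 (x : V * W) : x != 0 -> 0 < prod_inner x x.
Proof.
case: x => x y; rewrite -pair_eqE negb_and /prod_inner/= => /orP[x0|y0].
  by rewrite ltr_wpDr ?dot_ge0// dot_gt0.
by rewrite ltr_wpDl ?dot_ge0// dot_gt0.
Qed.

HB.instance Definition _ :=
  isDotProduct.Build R (V * W)%type prod_inner prod_gt0.

HB.instance Definition _ := @isEuclidean.Build R (V * W)%type prod_inner.

Lemma dot_prodE (x y : V * W) : dot x y = dot x.1 y.1 + dot x.2 y.2.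
Proof. by []. Qed.

End prod_euclidean.

Lemma dot_regularE (R : realType) (x y : R^o) : dot x y = x * y.
Proof. by []. Qed.

Section duality.
Context {R : realType}.

(* Meaningful when f is linear (see rieszP); an arbitrary vector otherwise. *)
Definition riesz {V : euclideanType R} (f : V -> R) : V :=
  get [set v : V | forall x, f x = dot v x].

Lemma rieszP (V : euclideanType R) (f : {scalar V}) x : f x = dot (riesz f) x.
Proof.
suff [v vP] : exists v : V, forall x, f x = dot v x.
  by have /(_ x) := @getI _ [set v | forall x, f x = dot v x] v vP.
pose d (v : V) : 'Hom(V, R^o) := linfun (inner v : V -> R^o).
have dE v y : d v y = dot v y by rewrite /d lfunE.
have dlin : linear d.
  move=> a u v; apply/lfunP => y.
  by rewrite add_lfunE scale_lfunE !dE dotDl dotZl.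
pose dL := GRing.isLinear.Build _ _ _ _ d dlin.
pose d' : {linear V -> 'Hom(V, R^o)} := HB.pack d dL.
have kd : lker (linfun d') == 0%VS.
  apply/lker0P => u v; rewrite !lfunE /= => /(congr1 (fun h => h - d v)).
  rewrite subrr => uv; apply/eqP; rewrite -subr_eq0; apply/negPn/negP => uv0.
  have := dot_gt0 uv0; rewrite -[in ltRHS]dE.
  have -> : d (u - v) = d u - d v by exact: (linearB d').
  by rewrite uv lfunE/= ltxx.
have : (linfun d' @: fullv == fullv)%VS.
  rewrite eqEdim subvf/= limg_dim_eq ?(eqP kd) ?capv0//.
  by rewrite !dimvf /dim/= muln1.
move=> /eqP dfull; have : linfun f \in (linfun d' @: fullv)%VS.
  by rewrite dfull memvf.
move=> /memv_imgP[v _]; rewrite lfunE/= => fv; exists v => y.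
by rewrite -dE -fv lfunE.
Qed.

Definition adjoint {V W : euclideanType R} (A : 'Hom(V, W)) (y : W) : V :=
  riesz (fun x => dot y (A x)).

Lemma adjointP (V W : euclideanType R) (A : 'Hom(V, W)) x y :
  dot (adjoint A y) x = dot y (A x).
Proof.
pose f z : R := dot y (A z).
have flin : scalar f by move=> a u v; rewrite /f linearP dotDr dotZr.
pose fL := GRing.isLinear.Build _ _ _ _ f flin.
pose f' : {scalar V} := HB.pack f fL.
exact/esym/(rieszP f').
Qed.

Definition gradient {V : euclideanType R} (f : V -> R^o) (x : V) : V :=
  riesz ('d f x).

Lemma gradientP (V : euclideanType R) (f : V -> R^o) (x h : V) :
  'd f x h = dot (gradient f x) h.
Proof. exact: (rieszP ('d f x)). Qed.

(* An operator, not a bilinear form: the second derivative in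
   the direction w is dot w (hessian f x w). *)
Definition hessian {V : euclideanType R} (f : V -> R^o) (x : V) :
  {linear V -> V} := 'd (gradient f) x.

End duality.

Section convex_analysis.
Context {R : realType} {V : euclideanType R}.

Definition epi (f : V -> \bar R) : set (V * R^o) :=
  [set p | (f p.1 <= (p.2 : R)%:E)%E].

Definition conjugate (f : V -> \bar R) (y : V) : \bar R :=
  ereal_sup [set ((dot y x)%:E - f x)%E | x in [set: V]].

Definition proper_function (f : V -> \bar R) : Prop :=
  (forall x, f x != -oo%E) /\ (exists x, f x != +oo%E).

Definition closed_function (f : V -> \bar R) : Prop := closed (epi f).

(* The library's [convex_function] only covers real-valued functions. *)
Definition convex_efunction (f : V -> \bar R) : Prop := convex_set (epi f).

End convex_analysis.

Section variational_analysis.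
Context {R : realType}.

Definition convex_normal_cone {V : euclideanType R} (Theta : set V) (xb : V) :
    set V :=
  [set y | Theta xb /\ forall x, Theta x -> dot y (x - xb) <= 0].

(* Over the deleted neighbourhoods of xb: when xb is isolated in S the limsup
   is -oo and every vector is a regular normal. *)
Definition regular_normal_cone {V : euclideanType R} (S : set V) (xb : V) :
    set V :=
  [set y | S xb /\
    (limf_esup (fun x => (dot y (x - xb) / enorm (x - xb))%:E)
               (within S xb^') <= 0)%E].

Definition limiting_normal_cone {V : euclideanType R} (S : set V) (xb : V) :
    set V :=
  [set y | S xb /\ exists x_ y_ : nat -> V,
    [/\ x_ @ \oo --> xb, y_ @ \oo --> y,
        forall k, S (x_ k) &
        forall k, regular_normal_cone S (x_ k) (y_ k)]].

Definition gph {V W : euclideanType R} (F : V -> set W) : set (V * W) :=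
  [set p | F p.1 p.2].

Definition coderivative {V W : euclideanType R} (F : V -> set W)
    (xb : V) (yb : W) (w : W) : set V :=
  [set z | limiting_normal_cone (gph F) (xb, yb) (z, - w)].

End variational_analysis.

Record dual_param (R : realType) (X Y : euclideanType R) := DualParam {
  par_A : 'Hom(X, Y) ;
  par_b : Y ;
  par_mu : R ;
  par_v : X
}.

Section dual_problem.
Context {R : realType} {X Y : euclideanType R}.
Implicit Types (p : dual_param X Y) (u w : Y * R^o) (lambda : X * R^o).

Definition Gmap u p : X * R^o := (adjoint (par_A p) u.1 + par_v p, u.2).

Definition lagrangian u p lambda : R^o :=
  par_mu p / 2 * enorm u.1 ^+ 2 - dot (par_b p) u.1 + u.2
  + dot lambda.1 (adjoint (par_A p) u.1 + par_v p) + lambda.2 * u.2.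

Definition dual_objective (b : Y) (mu : R) u : R :=
  mu / 2 * enorm u.1 ^+ 2 - dot b u.1 + u.2.

Definition dual_feasible (g : X -> \bar R) (A : 'Hom(X, Y)) : set (Y * R^o) :=
  [set u | epi (conjugate g) (adjoint A u.1, u.2)].

Definition dual_solution (g : X -> \bar R) (A : 'Hom(X, Y)) (b : Y) (mu : R)
    u : Prop :=
  dual_feasible g A u /\
  forall u', dual_feasible g A u' ->
    dual_objective b mu u <= dual_objective b mu u'.

(* ereal_inf set0 = +oo, so w is unconstrained when the coderivative is empty. *)
Definition generalized_SSOSC (Theta : set (X * R^o)) u p lambda : Prop :=
  let H := hessian (fun u' => lagrangian u' p lambda) u in
  let J := 'd (fun u' => Gmap u' p) u in
  forall w, w != 0 ->
    (0 < (dot w (H w))%:E +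
         ereal_inf [set (dot z (J w))%:E | z in
           coderivative (convex_normal_cone Theta) (Gmap u p) lambda (J w)])%E.

End dual_problem.

(* Main.v *)
Require Import Defs.
From HB Require Import structures.
From mathcomp Require Import all_boot all_order all_algebra.
From mathcomp Require Import all_classical all_reals all_analysis.
From mathcomp Require Import ring lra.
Import Order.TTheory GRing.Theory Num.Theory.
Import numFieldNormedType.Exports.
Import VectorInternalTheory.
Local Open Scope classical_set_scope.
Local Open Scope ring_scope.

(* Since Theta = epi g^* is closed and convex, N_Theta is maximal monotone, so
   every regular normal (z, w) to its graph satisfies <z, w> <= 0; hence z in
   D^*N_Theta(w) implies <z, w> >= 0. Moreover N_Theta has conical values, so
   (x, v) can be moved along (0, v) in the graph and <w, v> = 0 whenever
   D^*N_Theta(x | v)(w) is nonempty. The first term of the condition is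
   mu |w_1|^2. If w_1 <> 0 it is positive and the infimum is nonnegative; if
   w_1 = 0 and w_2 <> 0 then J_u G w = (0, w_2) is not orthogonal to
   (lambda_1, -1), so the coderivative is empty and the infimum is +oo. *)

(** * Continuity of linear maps and compactness in finite dimension *)

Section finite_dimension.
Context {R : realType}.

Lemma rV_linear_continuous {W : normedModType R} n
  (f : {linear 'rV[R]_n -> W}) : continuous f.
Proof.
have -> : (f : _ -> _) =
    (fun c => \sum_(i < n) c ord0 i *: f (delta_mx ord0 i)).
  apply/funext => c; rewrite {1}(row_sum_delta c) linear_sum.
  by apply: eq_bigr => i _; rewrite linearZ.
apply: continuous_big => [|i _ c]; first exact: add_continuous.
exact/continuousZr_tmp/coord_continuous.
Qed.

(** The minimum of [f] over the compact unit sphere serves as [m]; homogeneity extends the bound to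
    all vectors. *)
Lemma homogeneous_lower_bound n (f : 'rV[R]_n -> R) :
  continuous f -> (forall a c, f (a *: c) = `|a| * f c) ->
  (forall c, c != 0 -> 0 < f c) ->
  exists2 m, 0 < m & forall c, m * `|c| <= f c.
Proof.
move=> fcont fZ f_gt0; pose S := [set c : 'rV[R]_n | `|c| = 1].
have f0 : f 0 = 0 by rewrite -(scale0r 0) fZ normr0 mul0r.
have nS c : c != 0 -> S (`|c|^-1 *: c).
  by move=> c0; rewrite /S/= normrZ normfV normr_id mulVf// normr_eq0.
have Scompact : compact S.
  apply: bounded_closed_compact.
    by exists 1; split=> // M M1 c /= ->; exact: ltW.
  have -> : S = (fun c : 'rV[R]_n => `|c|) @^-1` [set 1] by [].
  apply: closed_comp => [c _|]; first exact: norm_continuous.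
  exact: closed_eq.
(* The sphere is empty only for [n = 0], where every vector is zero. *)
have [S0|S0] := pselect (S !=set0); last first.
  exists 1 => // c; have [->|c0] := eqVneq c 0.
    by rewrite normr0 mulr0 f0.
  by exfalso; apply: S0; exists (`|c|^-1 *: c); exact: nS.
have [c1 /[!inE] Sc1 c1min] := compact_EVT_min S0 Scompact
  (continuous_subspaceT fcont).
exists (f c1).
  apply: f_gt0; apply/negP => /eqP c10; move: Sc1.
  by rewrite /S/= c10 normr0 => /eqP; rewrite eq_sym oner_eq0.
move=> c; have [->|c0] := eqVneq c 0; first by rewrite normr0 mulr0 f0.
have := c1min (`|c|^-1 *: c); rewrite inE => /(_ (nS _ c0)).
by rewrite fZ normfV normr_id ler_pdivlMl ?normr_gt0// mulrC.
Qed.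

(** The norm of [V] pulled back along [r2v] dominates a positive multiple of the coordinate norm,
    which makes [v2r] bounded. *)
Lemma v2r_continuous (V : euclideanType R) :
  continuous (v2r : V -> 'rV[R]_(dim V)).
Proof.
have [|a c|c c0|m m0 mf] :=
  @homogeneous_lower_bound _ (fun c : 'rV[R]_(dim V) => `|r2v c : V|).
- move=> c; apply: (@continuous_comp _ _ _ (r2v : _ -> V) (fun x => `|x|)).
    exact: rV_linear_continuous.
  exact: norm_continuous.
- by rewrite linearZ/= normrZ.
- rewrite normr_gt0; apply: contra c0 => /eqP/(congr1 v2r).
  by rewrite r2vK linear0 => ->.
apply: bounded_linear_continuous; apply/linear_boundedP.
exists m^-1; split=> [|k mk x]; first by rewrite realE invr_ge0 (ltW m0).
have := mf (v2r x); rewrite v2rK -ler_pdivlMl// => /le_trans; apply.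
by rewrite ler_wpM2r// ltW.
Qed.

Lemma findim_linear_continuous {V : euclideanType R} {W : normedModType R}
  (f : {linear V -> W}) : continuous f.
Proof.
have -> : (f : _ -> _) = (f \o r2v) \o v2r.
  by apply/funext => x /=; rewrite v2rK.
move=> x; apply: continuous_comp; first exact: v2r_continuous.
exact: (rV_linear_continuous _ (f \o r2v)).
Qed.

(** Heine-Borel is transported from row vectors: [K] is the image under [r2v] of its preimage, which
    is closed, and bounded because [v2r] is Lipschitz. *)
Lemma findim_bounded_closed_compact {V : euclideanType R} (K : set V) :
  bounded_set K -> closed K -> compact K.
Proof.
move=> [M [Mreal KM]] Kc.
have -> : K = r2v @` ((r2v : _ -> V) @^-1` K).
  apply/seteqP; split=> [x Kx|_ [c Kc' <-]//].
  by exists (v2r x); rewrite /= v2rK.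
apply: continuous_compact.
  by apply: continuous_subspaceT; exact: rV_linear_continuous.
apply: bounded_closed_compact; last first.
  by apply: closed_comp => // c _; exact: rV_linear_continuous.
have [k k0 kv2r] := linear_lipschitz (@v2r_continuous V).
exists (k * (M + 1)); split=> [|N MN c Kc']; first exact: num_real.
apply: le_trans (ltW MN); rewrite -{1}(r2vK c); apply: le_trans (kv2r _) _.
by rewrite ler_pM2l//; apply: KM => //; rewrite ltrDl.
Qed.

End finite_dimension.

(** * The inner product, its norm, and comparison with the norm carrying the topology *)

Section euclidean_norm.
Context {R : realType} {V : euclideanType R}.
Implicit Types x y : V.

Lemma dot0l y : dot 0 y = 0.
Proof. by rewrite -(scale0r (0 : V)) dotZl mul0r. Qed.

Lemma dot0r y : dot y 0 = 0.
Proof. by rewrite dotC dot0l. Qed.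

Lemma dotNl x y : dot (- x) y = - dot x y.
Proof. by rewrite -scaleN1r dotZl mulN1r. Qed.

Lemma dotNr x y : dot x (- y) = - dot x y.
Proof. by rewrite dotC dotNl dotC. Qed.

Lemma dotBl x y z : dot (x - y) z = dot x z - dot y z.
Proof. by rewrite dotDl dotNl. Qed.

Lemma dotBr x y z : dot z (x - y) = dot z x - dot z y.
Proof. by rewrite dotDr dotNr. Qed.

Lemma enorm_ge0 x : 0 <= enorm x.
Proof. exact: sqrtr_ge0. Qed.

Lemma enorm_sqr x : enorm x ^+ 2 = dot x x.
Proof. by rewrite sqr_sqrtr// dot_ge0. Qed.

Lemma enorm_gt0 x : x != 0 -> 0 < enorm x.
Proof. by move=> /dot_gt0; rewrite -sqrtr_gt0. Qed.

Lemma enormZ (a : R) x : enorm (a *: x) = `|a| * enorm x.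
Proof.
by rewrite /enorm dotZl dotZr mulrA -expr2 sqrtrM ?sqr_ge0// sqrtr_sqr.
Qed.

Lemma enorm_le x (a : R) : 0 <= a -> dot x x <= a ^+ 2 -> enorm x <= a.
Proof.
move=> a0 xa.
by rewrite -(ler_pXn2r (n := 2))// ?nnegrE ?enorm_ge0// enorm_sqr.
Qed.

Lemma cauchy_schwarz x y : dot x y <= enorm x * enorm y.
Proof.
have [->|x0] := eqVneq x 0; first by rewrite dot0l mulr_ge0// enorm_ge0.
have [->|y0] := eqVneq y 0; first by rewrite dot0r mulr_ge0// enorm_ge0.
(* This square expands to [2 |x| |y| (|x| |y| - <x, y>)]. *)
have := dot_ge0 (enorm y *: x - enorm x *: y).
rewrite dotBl !dotBr !dotZl !dotZr (dotC y x) -!enorm_sqr => xy.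
have xy0 : 0 < enorm x * enorm y by rewrite mulr_gt0 ?enorm_gt0.
rewrite -(ler_pM2l xy0); lra.
Qed.

Lemma dot_ext x y : (forall z, dot x z = dot y z) -> x = y.
Proof.
move=> xy; apply/eqP; rewrite -subr_eq0; apply/negP => /negP/dot_gt0.
by rewrite dotBl xy subrr ltxx.
Qed.

(** The topology of [V] is not defined from the inner product, so continuity comes from coordinates:
    [dot] is a finite sum of products of linear forms. *)
Lemma dot_continuous : continuous (fun p : V * V => dot p.1 p.2).
Proof.
have -> : (fun p : V * V => dot p.1 p.2) = fun p => \sum_(i < dim V)
    v2r p.1 ord0 i * dot (r2v (delta_mx ord0 i)) p.2.
  apply/funext => p.
  rewrite -{1}(v2rK p.1) {1}(row_sum_delta (v2r p.1)) linear_sum/=.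
  elim/big_ind2: _ => [|a b a' b' <- <-|i _]; first by rewrite dot0l.
    by rewrite dotDl.
  by rewrite linearZ/= dotZl.
apply: continuous_big => [|i _ p]; first exact: add_continuous.
pose e : V := r2v (delta_mx ord0 i).
have c1 : {for p.1, continuous (fun x : V => v2r x ord0 i)}.
  apply: (@continuous_comp _ _ _ v2r (fun c : 'rV_(dim V) => c ord0 i)).
    exact: v2r_continuous.
  exact: coord_continuous.
have c2 : {for p.2, continuous (inner e : V -> R^o)}.
  exact: findim_linear_continuous.
apply: (@continuousM R (V * V)%type (fun p => v2r p.1 ord0 i)
  (fun p => dot e p.2)).
  exact: (@continuous_comp _ _ _ fst (fun x : V => v2r x ord0 i) p cvg_fst c1).
exact: (@continuous_comp _ _ _ snd (inner e : V -> R^o) p cvg_snd c2).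
Qed.

Lemma cvg_dot {T : Type} {F : set_system T} {FF : Filter F} {f g : T -> V}
    {x y} :
  f @ F --> x -> g @ F --> y -> dot (f t) (g t) @[t --> F] --> dot x y.
Proof.
move=> fx gy.
exact: (@cvg_comp _ _ _ (fun t => (f t, g t)) _ _ _ _ (cvg_pair fx gy)
  (@dot_continuous (x, y))).
Qed.

(** Converts estimates in [enorm] into boundedness and neighbourhoods for the topology of [V]. *)
Lemma norm_le_enorm : exists2 k : R, 0 < k & forall x, `|x| <= k * enorm x.
Proof.
have ec : continuous (fun c : 'rV[R]_(dim V) => enorm (r2v c : V)).
  move=> c.
  have r2vc := @rV_linear_continuous _ V _ (r2v : {linear _ -> V}) c.
  have dc := cvg_dot (FF := nbhs_filter c) r2vc r2vc.
  have sc := @sqrt_continuous R (dot (r2v c : V) (r2v c)).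
  exact: (cvg_comp _ _ dc sc).
have [a c|c c0|m m0 mf] := homogeneous_lower_bound _ _ ec.
- by rewrite linearZ/= enormZ.
- apply: enorm_gt0; apply: contra c0 => /eqP/(congr1 v2r).
  by rewrite r2vK linear0 => ->.
have [k k0 kr2v] := linear_lipschitz (@rV_linear_continuous _ V _ r2v).
exists (k / m) => [|x]; first by rewrite divr_gt0.
rewrite -{1}(v2rK x); apply: le_trans (kr2v _) _.
by rewrite -mulrA ler_pM2l// ler_pdivlMl// -{2}(v2rK x).
Qed.

End euclidean_norm.

(** * Convex normal cones, projections and Minty's theorem *)

Section convex_normal_cone.
Context {R : realType} {V : euclideanType R}.
Implicit Types (x v s : V) (Theta : set V).

Lemma convex_normal_cone_monotone Theta x x' v v' :
  convex_normal_cone Theta x v -> convex_normal_cone Theta x' v' ->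
  0 <= dot (x' - x) (v' - v).
Proof.
move=> [Tx vx] [Tx' vx']; have := vx _ Tx'; have := vx' _ Tx.
rewrite !(dotBr, dotBl) (dotC x' v') (dotC x v') (dotC x' v) (dotC x v); lra.
Qed.

Lemma convex_normal_coneZ Theta x v (a : R) :
  0 <= a -> convex_normal_cone Theta x v -> convex_normal_cone Theta x (a *: v).
Proof.
by move=> a0 [Tx vx]; split=> // x' /vx vx'; rewrite dotZl mulr_ge0_le0.
Qed.

Lemma nearest_point_exists Theta s : closed Theta -> Theta !=set0 ->
  exists2 x, Theta x &
    forall x', Theta x' -> dot (s - x) (s - x) <= dot (s - x') (s - x').
Proof.
move=> Tclosed [x0 Tx0].
pose q x : R := dot (s - x) (s - x).
have qc : continuous q.
  move=> x; have sx : (fun x => s - x) @ x --> s - x.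
    by apply: cvgB; [exact: cvg_cst|exact: cvg_id].
  exact: (cvg_dot (FF := nbhs_filter x) sx sx).
(* Only points at least as close to [s] as [x0] matter; they form a bounded closed set. *)
pose K := Theta `&` (q @^-1` [set r | r <= q x0]).
have [k k0 kV] := @norm_le_enorm R V.
have Kcompact : compact K.
  apply: findim_bounded_closed_compact.
    exists (`|s| + k * Num.sqrt (q x0)); split=> [|N MN x [_ /= qx]].
      exact: num_real.
    apply: le_trans (ltW MN).
    rewrite -[x in `|x|](subKr s) (le_trans (ler_normB _ _))// lerD2l.
    by rewrite (le_trans (kV _))// ler_pM2l// ler_wsqrtr.
  apply: closedI => //; apply: closed_comp => [x _|]; first exact: qc.
  exact: closed_le.
have K0 : K !=set0 by exists x0; split=> //=.
have [x /[!inE] -[Tx _] xmin] := compact_EVT_min K0 Kcompact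
  (continuous_subspaceT qc).
exists x => // x' Tx'; have [qx'|/ltW qx'] := leP (q x') (q x0).
  by apply: xmin; rewrite inE.
by apply: le_trans qx'; apply: xmin; rewrite inE; split=> //=.
Qed.

(** Otherwise a short step from [x] towards some point of [Theta] would come strictly closer to
    [s]. *)
Lemma nearest_point_normal Theta s x : convex_set Theta -> Theta x ->
  (forall x', Theta x' -> dot (s - x) (s - x) <= dot (s - x') (s - x')) ->
  convex_normal_cone Theta x (s - x).
Proof.
move=> Tconv Tx xmin; split=> // x' Tx'; rewrite leNgt; apply/negP.
set h := x' - x; set v := s - x => D0.
have H0 := dot_ge0 h; set D := dot v h in D0; set H := dot h h in H0.
(* This step length lies in [(0, 1]], and [r (D + H) = D] gives
   [|v - r h|^2 = |v|^2 - r D - r^2 D]. *)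
pose r := D / (D + H).
have DH : 0 < D + H by rewrite ltr_wpDr.
have r0 : 0 < r by rewrite divr_gt0.
have r1 : r <= 1 by rewrite ler_pdivrMr// mul1r lerDl.
have /xmin : Theta (x + r *: h).
  have := Tconv x' x (Itv01 (ltW r0) r1); rewrite !inE => /(_ Tx' Tx).
  congr Theta; rewrite /h scalerBr addrCA; congr (_ + _).
  by rewrite /conv/= [in LHS]scalerBl scale1r.
rewrite opprD addrA -/v; clearbody h v.
rewrite dotBl !dotBr !dotZl !dotZr (dotC h v) -/D -/H.
have rDH : r * (D + H) = D by rewrite /r divfK// gt_eqF.
have -> : r * (r * H) = r * D - r * r * D by rewrite -[in r * D]rDH; ring.
have := mulr_gt0 r0 D0; have := mulr_gt0 r0 (mulr_gt0 r0 D0); lra.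
Qed.

(* Minty's theorem for normal cone mappings. *)
Lemma convex_normal_cone_surj Theta s :
  closed Theta -> convex_set Theta -> Theta !=set0 ->
  exists x v, convex_normal_cone Theta x v /\ x + v = s.
Proof.
move=> Tclosed Tconv T0.
have [x Tx xmin] := nearest_point_exists _ s Tclosed T0.
exists x, (s - x); split; last by rewrite addrC subrK.
exact: nearest_point_normal.
Qed.

End convex_normal_cone.

(** * Regular normals to the graph of the normal cone mapping, and its coderivative *)

Section coderivative.
Context {R : realType}.

(** Epsilon-delta form of the limsup condition; both sides vanish at [x = xb], so the deleted point
    can be restored. *)
Lemma regular_normal_coneP {V : euclideanType R} (S : set V) xb y :
  regular_normal_cone S xb y -> forall e, 0 < e ->
  exists2 d, 0 < d & forall x, S x -> enorm (x - xb) < d ->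
    dot y (x - xb) <= e * enorm (x - xb).
Proof.
move=> [Sxb yS] e e0.
have : (limf_esup (fun x => (dot y (x - xb) / enorm (x - xb))%:E)
    (within S xb^') < e%:E)%E by rewrite (le_lt_trans yS)// lte_fin.
rewrite limf_esupE => /ereal_inf_lt[_ [U SU <-] Ue].
have /nbhs_ballP[r /= r0 rU] := SU.
have [k k0 kV] := @norm_le_enorm R V.
exists (r / k) => [|x Sx xd]; first by rewrite divr_gt0.
have [->|xxb] := eqVneq x xb.
  by rewrite subrr dot0r mulr_ge0// ?enorm_ge0// ltW.
have Ux : U x.
  apply: rU => //=; rewrite -ball_normE/= distrC (le_lt_trans (kV _))//.
  by rewrite mulrC -ltr_pdivlMr.
rewrite -ler_pdivrMr ?enorm_gt0 ?subr_eq0// -lee_fin.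
by apply: le_trans (ltW Ue); apply: ereal_sup_ubound; exists x.
Qed.

Context {V : euclideanType R} (Theta : set V).
Hypothesis Theta_closed : closed Theta.
Hypothesis Theta_convex : convex_set Theta.
Let N := convex_normal_cone Theta.

(* By Minty's theorem the graph of [N] contains [(x + p, v + q)] with
   [p + q = t (z + w)]; monotonicity makes [p - q] no longer than [p + q], and
   [2 (<z, p> + <w, q>) = <z + w, p + q> + <z - w, p - q>]. *)
Lemma regular_normal_gph_dot_le0 x v z w :
  regular_normal_cone (gph N) (x, v) (z, w) -> dot z w <= 0.
Proof.
move=> zw; have [Nxv _] := zw; have [Tx _] := Nxv.
rewrite leNgt; apply/negP => zw0.
set a := enorm (z + w); set b := enorm (z - w).
(* [a^2 - b^2 = 4 <z, w>]. *)
have ba : b < a.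
  rewrite -(ltr_pXn2r (n := 2))// ?nnegrE ?enorm_ge0// !enorm_sqr.
  by rewrite !(dotBl, dotBr, dotDl, dotDr) (dotC w z); lra.
have a0 : 0 < a by rewrite (le_lt_trans _ ba)// enorm_ge0.
(* With this slack the normal inequality caps [2 (<z, p> + <w, q>)] at [t a (a - b) / 2], while the
   identity above bounds it below by [t a (a - b)]. *)
have e0 : 0 < (a - b) / 4 by rewrite divr_gt0// subr_gt0.
have [d d0 dP] := regular_normal_coneP _ _ _ zw _ e0.
pose t := d / (2 * a).
have t0 : 0 < t by rewrite divr_gt0// mulr_gt0.
have ta : t * a = d / 2 by rewrite /t; field; rewrite gt_eqF.
have [x' [v' [Nxv' sum]]] := convex_normal_cone_surj _
  (x + v + t *: (z + w)) Theta_closed Theta_convex (ex_intro _ x Tx).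
set p := x' - x; set q := v' - v.
have pq : p + q = t *: (z + w).
  by rewrite /p /q addrACA sum -opprD addrAC subrr add0r.
have pq0 : 0 <= dot p q by exact: convex_normal_cone_monotone Nxv Nxv'.
have {dP} := dP (x', v') Nxv'.
rewrite -[(x', v') - (x, v)]/(p, q) dot_prodE/= => dP; clearbody p q.
have pqa : dot (p + q) (p + q) = (t * a) ^+ 2.
  by rewrite pq dotZl dotZr -enorm_sqr -/a; ring.
have ta0 : 0 <= t * a by rewrite mulr_ge0// ltW.
(* [|p|^2 + |q|^2 = |p + q|^2 - 2 <p, q>], and below [|q - p|^2 = |p + q|^2 - 4 <p, q>]. *)
have le1 : enorm (p, q) <= t * a.
  apply: enorm_le => //; rewrite -pqa dot_prodE/= !(dotDl, dotDr) (dotC q p).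
  lra.
have le2 : enorm (q - p) <= t * a.
  apply: enorm_le => //.
  rewrite -pqa !(dotBl, dotBr, dotDl, dotDr) (dotC q p); lra.
have d2 : t * a < d by rewrite ta; lra.
have zpwq := le_trans (dP (le_lt_trans le1 d2)) (ler_wpM2l (ltW e0) le1).
have := le_trans (cauchy_schwarz (z - w) (q - p)) (ler_wpM2l (enorm_ge0 _) le2).
have : dot (z + w) (p + q) = a * (t * a).
  by rewrite pq dotZr -enorm_sqr -/a; ring.
have : 0 < t * a * (a - b) by rewrite mulr_gt0 ?subr_gt0// mulr_gt0.
rewrite -/b !(dotBl, dotBr, dotDl, dotDr); lra.
Qed.

(** The graph can be followed from [(x, v)] along both [(0, v)] and [(0, - v)], so [<w, v>] can have
    neither sign. *)
Lemma regular_normal_gph_dot_eq0 x v z w :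
  regular_normal_cone (gph N) (x, v) (z, w) -> dot w v = 0.
Proof.
move=> zw; have [Nxv _] := zw; apply/eqP/negP => /negP wv0.
have v0 : 0 < enorm v.
  by apply: enorm_gt0; apply: contra wv0 => /eqP ->; rewrite dot0r.
have wvn0 : 0 < `|dot w v| by rewrite normr_gt0.
(* With this slack the normal inequality allows only half of the actual increment [t |<w, v>|]. *)
have e0 : 0 < `|dot w v| / (2 * enorm v) by rewrite divr_gt0// mulr_gt0.
have [d d0 dP] := regular_normal_coneP _ _ _ zw _ e0.
(* The bound by [1] keeps [1 + a] nonnegative below; the other keeps the displacement shorter than
   [d]. *)
pose t := Num.min 1 (d / (2 * enorm v)).
have t0 : 0 < t by rewrite lt_min ltr01 divr_gt0// mulr_gt0.
have t1 : t <= 1 by rewrite ge_min lexx.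
have td : t * enorm v < d.
  rewrite -ltr_pdivlMr// gt_min; apply/orP; right.
  by rewrite ltr_pM2l// ltf_pV2 ?posrE ?mulr_gt0//; lra.
pose a := Num.sg (dot w v) * t.
have at_ : `|a| = t by rewrite normrM normr_sg wv0 mul1r gtr0_norm.
have Nxav : N x ((1 + a) *: v).
  apply: convex_normal_coneZ => //.
  by rewrite -lerBlDl sub0r lerNl (le_trans (ler_norm _))// normrN at_.
have nE : enorm ((0 : V), a *: v) = t * enorm v.
  by rewrite /enorm dot_prodE/= dot0l add0r -/(enorm _) enormZ at_.
have := dP (x, (1 + a) *: v) Nxav.
have -> : (x, (1 + a) *: v) - (x, v) = ((0 : V), a *: v).
  by congr pair; rewrite /= ?subrr// scalerDl scale1r addrC addKr.
rewrite nE dot_prodE/= dot0r add0r dotZr => /(_ td).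
have -> : a * dot w v = t * `|dot w v| by rewrite /a mulrAC -normrEsg mulrC.
have -> : `|dot w v| / (2 * enorm v) * (t * enorm v) = t * `|dot w v| / 2.
  by field; rewrite gt_eqF.
have := mulr_gt0 t0 wvn0; lra.
Qed.

(** The sign condition on regular normals passes to their limit [(z, - w)]; the minus sign reverses
    it. *)
Lemma coderivative_dot_ge0 x v w z : coderivative N x v w z -> 0 <= dot z w.
Proof.
move=> [_ [x_ [y_ [_ y_cvg _ yP]]]].
have y1 : (y_ k).1 @[k --> \oo] --> z.
  exact: (cvg_comp _ _ y_cvg cvg_fst).
have y2 : (y_ k).2 @[k --> \oo] --> - w.
  exact: (cvg_comp _ _ y_cvg cvg_snd).
rewrite -oppr_le0 -dotNr.
apply: (cvgr_to_le (cvg_dot y1 y2)); apply: nearW => k.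
have := yP k; case: (x_ k) (y_ k) => [? ?] [? ?].
exact: regular_normal_gph_dot_le0.
Qed.

(** The base points converge along with the normals, so orthogonality also passes to the limit. *)
Lemma coderivative_dot_eq0 x v w z : coderivative N x v w z -> dot w v = 0.
Proof.
move=> [_ [x_ [y_ [x_cvg y_cvg _ yP]]]].
have x2 : (x_ k).2 @[k --> \oo] --> v.
  exact: (cvg_comp _ _ x_cvg cvg_snd).
have y2 : (y_ k).2 @[k --> \oo] --> - w.
  exact: (cvg_comp _ _ y_cvg cvg_snd).
apply/eqP; rewrite -oppr_eq0 -dotNl; apply/eqP.
apply: (cvg_unique _ (cvg_dot y2 x2)) => //.
have -> : (fun k => dot (y_ k).2 (x_ k).2) = cst 0.
  apply/funext => k; have := yP k; case: (x_ k) (y_ k) => [? ?] [? ?].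
  exact: regular_normal_gph_dot_eq0.
exact: cvg_cst.
Qed.

End coderivative.

(** * The epigraph of the conjugate as an intersection of half-spaces *)

Section conjugate_epigraph.
Context {R : realType} {V : euclideanType R} (g : V -> \bar R).

(** Indexing by points [(x, s)] of [epi g] rather than by [x] keeps infinite values out of the
    inequalities; closedness and convexity then reduce to half-spaces. *)
Lemma epi_conjugateE : epi (conjugate g) =
  \bigcap_(q in epi g) [set p | dot ((q.1, -1) : V * R^o) p <= q.2].
Proof.
rewrite /epi; apply/seteqP; split=> [[y t] /= yt [x s] /= gxs|[y t] /= yt].
  rewrite dot_prodE/= dot_regularE dotC.
  suff : ((dot y x - s)%:E <= t%:E)%E by rewrite lee_fin; lra.
  apply: (le_trans _ yt).
  apply: (@le_trans _ _ ((dot y x)%:E - g x)%E).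
    by rewrite EFinB leeB.
  by apply: ereal_sup_ubound; exists x.
apply: ge_ereal_sup => _ [x _ <-].
case gx : (g x) => [s| |] /=; last 2 first.
- by rewrite leNye.
(* Where [g x] is [-oo], every height over [x] lies in [epi g]; the half-space of this one excludes
   [(y, t)]. *)
- exfalso; have := yt (x, dot x y - t - 1).
  rewrite /= gx leNye dot_prodE/= dot_regularE => /(_ isT); lra.
have := yt (x, s); rewrite /= gx lexx dot_prodE/= dot_regularE => /(_ isT).
by rewrite -EFinB lee_fin dotC; lra.
Qed.

Lemma closed_epi_conjugate : closed (epi (conjugate g)).
Proof.
rewrite epi_conjugateE; apply: closed_bigI => q _.
pose a : V * R^o := (q.1, -1).
have ac : continuous (inner a : V * R^o -> R^o).
  exact: findim_linear_continuous.
exact: (closed_comp (fun p _ => ac p) (@closed_le R q.2)).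
Qed.

Lemma convex_epi_conjugate : convex_set (epi (conjugate g)).
Proof.
rewrite epi_conjugateE => p p' r; rewrite !inE => pT p'T q gq.
have := pT q gq; have := p'T q gq; rewrite /= dotDr !dotZr => p1 p2.
have r0 : 0 <= r%:num by [].
have r1 : 0 <= 1 - r%:num by rewrite subr_ge0.
have := ler_wpM2l r0 p2; have := ler_wpM2l r1 p1; rewrite /unstable.onem; lra.
Qed.

End conjugate_epigraph.

(** * Derivatives of affine and quadratic functions *)

Section differentials.
Context {R : realType} {V : euclideanType R}.

Lemma diff_affine {W : normedModType R} (L : {linear V -> W}) (c : W) x :
  'd (fun u => L u + c) x = L :> (V -> W).
Proof.
have Lc := @findim_linear_continuous _ _ _ L.
have -> : (fun u => L u + c) = (L : V -> W) + cst c by [].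
rewrite diffD; last 2 first.
- exact: linear_differentiable.
- exact: differentiable_cst.
by rewrite diff_cst diff_lin//; apply/funext => u /=; rewrite addr0.
Qed.

(** Chain rule for the bilinear inner product composed with [u |-> (L u, u)]. *)
Lemma is_diff_dot_diag (L : {linear V -> V}) x :
  is_diff x (fun u => dot (L u) u : R^o) (fun h => dot (L x) h + dot (L h) x).
Proof.
pose B (u v : V) : R^o := dot u v.
have Bbil : bilinear_for (GRing.Scale.Law.clone _ _ *:%R _)
    (GRing.Scale.Law.clone _ _ *:%R _) B.
  by split=> u a v w; rewrite /B/= ?dotDl ?dotDr ?dotZl ?dotZr.
pose BM := bilinear_isBilinear.Build R V V R^o _ _ B Bbil.
pose B' : {bilinear V -> V -> R^o} := HB.pack B BM.
have Bc : continuous (fun p => B' p.1 p.2) by exact: dot_continuous.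
have Lc := @findim_linear_continuous _ _ _ L.
have dL : is_diff x L L.
  by apply: DiffDef; [exact: linear_differentiable|exact: diff_lin].
have dB : is_diff (L x, x) (fun p => B' p.1 p.2)
    (fun p => dot (L x) p.2 + dot p.1 x).
  by apply: DiffDef; [exact: differentiable_bilin|exact: diff_bilin].
exact: (is_diff_comp (is_diff_pair dL (is_diff_id x)) dB).
Qed.

(** Symmetry of [Q] makes the two terms of the product rule equal, which absorbs the factor
    [1/2]. *)
Lemma gradient_quadratic (Q : {linear V -> V}) (a : V) (c : R) :
  (forall u v, dot (Q u) v = dot u (Q v)) ->
  gradient (fun u => 2^-1 * dot (Q u) u + dot a u + c : R^o) =
    fun u => Q u + a.
Proof.
move=> Qsym; apply/funext => x; apply: dot_ext => h; rewrite -gradientP.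
have dQ := is_diff_dot_diag Q x.
have da : is_diff x (inner a : V -> R^o) (inner a).
  by apply: DiffDef; [apply: linear_differentiable|apply: diff_lin];
    exact: findim_linear_continuous.
have := is_diffD (is_diffD (is_diffZ 2^-1 dQ) da) (is_diff_cst (c : R^o) x).
move=> /@diff_val/(congr1 (fun f => f h)) dq.
apply: etrans dq _.
rewrite -[LHS]/(2^-1 * (dot (Q x) h + dot (Q h) x) + dot a h + 0) dotDl.
by rewrite (Qsym h) (dotC h); lra.
Qed.

End differentials.

(** * Derivatives of the constraint map and of the Lagrangian *)

Section dual_problem.
Context {R : realType} {X Y : euclideanType R}.
Implicit Types (p : dual_param X Y) (u w : Y * R^o) (lambda : X * R^o).

Lemma adjoint_linear (A : 'Hom(X, Y)) : linear (adjoint A).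
Proof.
by move=> a u v; apply: dot_ext => x; rewrite !(dotDl, dotZl, adjointP).
Qed.

Lemma diff_Gmap u p w :
  'd (fun u' => Gmap u' p) u w = (adjoint (par_A p) w.1, w.2).
Proof.
pose L w : X * R^o := (adjoint (par_A p) w.1, w.2).
have Llin : linear L.
  by move=> a v v'; rewrite /L/= adjoint_linear.
pose LM := GRing.isLinear.Build _ _ _ _ L Llin.
pose L' : {linear (Y * R^o)%type -> (X * R^o)%type} := HB.pack L LM.
have -> : (fun u' => Gmap u' p) = fun u' => L' u' + (par_v p, 0).
  by apply/funext => v; congr pair; rewrite /= ?addr0.
by rewrite diff_affine.
Qed.

Lemma hessian_lagrangian u p lambda w :
  hessian (fun u' => lagrangian u' p lambda) u w = (par_mu p *: w.1, 0).
Proof.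
pose Q w : Y * R^o := (par_mu p *: w.1, 0).
have Qlin : linear Q.
  move=> a v v'; rewrite /Q; congr pair; rewrite /= ?addr0 ?mulr0 ?scaler0//.
  by rewrite scalerDr !scalerA mulrC.
pose QM := GRing.isLinear.Build _ _ _ _ Q Qlin.
pose Q' : {linear (Y * R^o)%type -> (Y * R^o)%type} := HB.pack Q QM.
(* Moving the adjoint onto [lambda.1] exhibits a quadratic function of [u'], whose gradient is
   affine with linear part [Q']. *)
have -> : (fun u' => lagrangian u' p lambda) = (fun u' => 2^-1 * dot (Q' u') u'
    + dot ((par_A p lambda.1 - par_b p, 1 + lambda.2) : Y * R^o) u'
    + dot lambda.1 (par_v p)).
  apply/funext => -[y t]; rewrite /lagrangian !dot_prodE/= enorm_sqr.
  rewrite !dot_regularE dotDr (dotC _ (adjoint _ _)) adjointP.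
  rewrite dotBl dotZl (dotC y (par_A p _)); lra.
rewrite /hessian gradient_quadratic => [|v v']; first by rewrite diff_affine.
by rewrite !dot_prodE/= !dot_regularE dotZl dotZr mul0r mulr0.
Qed.

End dual_problem.

Theorem proposition3p4 (R : realType) (X Y : euclideanType R)
    (g : X -> \bar R)
    (g_closed : closed_function g)
    (g_proper : proper_function g)
    (g_convex : convex_efunction g)
    (A : 'Hom(X, Y)) (b : Y) (mu : R) (mu_gt0 : 0 < mu)
    (y : Y) (t : R^o)
    (sol : dual_solution g A b mu (y, t))
    (lambda1 : X)
    (stationarity : 0 = mu *: y - b + A lambda1)
    (multiplier : convex_normal_cone (epi (conjugate g))
                    (adjoint A y, t) (lambda1, -1)) :
  generalized_SSOSC (epi (conjugate g)) (y, t) (DualParam A b mu 0)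
    (lambda1, -1).
Proof.
move=> w w0; rewrite hessian_lagrangian diff_Gmap/=.
set u := Gmap _ _; set Jw := (adjoint A w.1, w.2).
set D := coderivative _ _ _ _.
have Tcl := closed_epi_conjugate g; have Tcv := convex_epi_conjugate g.
have D_ge0 z : D z -> 0 <= dot z Jw by exact: coderivative_dot_ge0.
have D_eq0 z : D z -> dot Jw (lambda1, -1 : R^o) = 0.
  exact: coderivative_dot_eq0.
have inf_ge0 : (0 <= ereal_inf [set (dot z Jw)%:E | z in D])%E.
  by apply: le_ereal_inf_tmp => _ [z /D_ge0 z0 <-]; rewrite lee_fin.
rewrite dot_prodE/= dot_regularE mulr0 addr0 dotZr.
have [w10|w10] := eqVneq w.1 0; last first.
  by apply: lt_le_trans (leeDl _ inf_ge0); rewrite lte_fin mulr_gt0// dot_gt0.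
suff -> : D = set0 by rewrite image_set0 ereal_inf0 addey.
(* With [w.1 = 0] the pairing of [Jw] with the multiplier is [- w.2], so an element of [D] would
   force [w = 0]. *)
rewrite -subset0 => z /D_eq0; apply/eqP.
rewrite dot_prodE/= dot_regularE mulrN1 adjointP w10 dot0l.
rewrite add0r oppr_eq0; apply: contra w0 => /eqP w20.
by apply/eqP; case: (w) w10 w20 => ? ? /= -> ->.
Qed.
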